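(* Let $(\mathfrak g,\omega,E)$ be a finite-dimensional para-Kähler $3$-Lie algebra over $\mathbb R$ or $\mathbb C$, let $\mathfrak g_\pm$ be the eigenspaces of $E$ for the eigenvalues $\pm1$, let $\nabla$ be the Levi-Civita product associated to the bilinear form $S(x,y)=\omega(x,Ey)$, and let $\{\cdot,\cdot,\cdot\}$ be the $3$-pre-Lie multiplication on $\mathfrak g$ determined by $\omega(\{x,y,z\},w)=-\omega(z,[x,y,w]_{\mathfrak g})$. Then for all $x_1,x_2,x_3\in\mathfrak g_+$ and $\alpha_1,\alpha_2,\alpha_3\in\mathfrak g_-$, $$\nabla_{x_1,x_2}x_3=\{x_1,x_2,x_3\},\qquad \nabla_{\alpha_1,\alpha_2}\alpha_3=\{\alpha_1,\alpha_2,\alpha_3\}.$$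
   Context: A $3$-Lie algebra is a vector space $\mathfrak g$ with a trilinear skew-symmetric bracket $[\cdot,\cdot,\cdot]_{\mathfrak g}$ satisfying $[x,y,[z,w,v]]=[[x,y,z],w,v]+[z,[x,y,w],v]+[z,w,[x,y,v]]$. A symplectic structure on $\mathfrak g$ is a nondegenerate skew-symmetric bilinear form $\omega$ with $\omega([x,y,z],w)-\omega([y,z,w],x)+\omega([z,w,x],y)-\omega([w,x,y],z)=0$ for all $x,y,z,w$. A product structure on $\mathfrak g$ is a linear map $E:\mathfrak g\to\mathfrak g$ with $E^2=\mathrm{Id}$, $E\neq\pm\mathrm{Id}$, such that for all $x,y,z\in\mathfrak g$: $E[x,y,z]=[Ex,Ey,Ez]+[Ex,y,z]+[x,Ey,z]+[x,y,Ez]-E[Ex,Ey,z]-E[x,Ey,Ez]-E[Ex,y,Ez]$. A paracomplex structure is a product structure whose $\pm1$-eigenspaces have the same dimension. A para-Kähler $3$-Lie algebra is a triple $(\mathfrak g,\omega,E)$ with $\omega$ symplectic, $E$ paracomplex and $\omega(Ex,Ey)=-\omega(x,y)$ for all $x,y\in\mathfrak g$. Then $S(x,y)=\omega(x,Ey)$ is a nondegenerate symmetric bilinear form. For a nondegenerate symmetric bilinear form $S$ on a $3$-Lie algebra $\mathfrak g$, the associated Levi-Civita product $\nabla:\mathfrak g^{\otimes3}\to\mathfrak g$, $(x,y,z)\mapsto\nabla_{x,y}z$, is defined by $$3S(\nabla_{x,y}z,w)=S([x,y,z]_{\mathfrak g},w)-2S([x,y,w]_{\mathfrak g},z)+S([y,z,w]_{\mathfrak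 g},x)+S([z,x,w]_{\mathfrak g},y)\quad\text{for all } w\in\mathfrak g.$$ *)

(* Defs.v *)
From HB Require Import structures.
From mathcomp Require Export all_boot all_order all_algebra.
From mathcomp Require Export reals complex.
From mathcomp Require Import boolp ring.

Set Implicit Arguments.
Unset Strict Implicit.
Unset Printing Implicit Defensive.

Import Num.Theory.
Export GRing.Theory.
Export passmx(leigenspace).
Local Open Scope ring_scope.

Inductive real_or_complex : fieldType -> Prop :=
| ground_real (R : realType) : real_or_complex R
| ground_complex (R : realType) : real_or_complex R[i].

Section ThreeLie.
Variables (K : fieldType) (g : vectType K).
Implicit Types (br pre nabla : g -> g -> g -> g) (S : g -> g -> K).
Implicit Types (omega : {skew_symmetric g}) (E : 'End(g)).

Definition trilinear br : Prop :=
  [/\ forall y z, linear (fun x => br x y z),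
      forall x z, linear (fun y => br x y z)
    & forall x y, linear (fun z => br x y z)].

(* The two adjacent transpositions generate all permutations of the three
   arguments. *)
Definition skew3 br : Prop :=
  (forall x y z, br y x z = - br x y z) /\
  (forall x y z, br x z y = - br x y z).

Definition fundamental_identity br : Prop := forall x y z w v,
  br x y (br z w v) = br (br x y z) w v + br z (br x y w) v
                      + br z w (br x y v).

Definition is_lie3 br : Prop :=
  [/\ trilinear br, skew3 br & fundamental_identity br].

Definition is_symplectic_on br omega : Prop :=
  nondegenerate omega /\
  forall x y z w, omega (br x y z) w - omega (br y z w) x
                  + omega (br z w x) y - omega (br w x y) z = 0.

Definition is_product_structure br E : Prop :=
  [/\ (E \o E)%VF = \1%VF,
      E <> \1%VF,
      E <> - \1%VF
    & forall x y z,
        E (br x y z) = br (E x) (E y) (E z)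
                       + br (E x) y z + br x (E y) z + br x y (E z)
                       - E (br (E x) (E y) z) - E (br x (E y) (E z))
                       - E (br (E x) y (E z))].

Definition is_paracomplex br E : Prop :=
  is_product_structure br E /\
  \dim (leigenspace E 1) = \dim (leigenspace E (-1)).

Definition is_para_kahler br omega E : Prop :=
  [/\ is_lie3 br, is_symplectic_on br omega, is_paracomplex br E
    & forall x y, omega (E x) (E y) = - omega x y].

Definition para_metric omega E : g -> g -> K := fun x y => omega x (E y).

(* The product [nabla x y z] (written $\nabla_{x,y}z$) is characterised by
   duality with [S]; see [levi_civita_exists] and [levi_civita_unique]. *)
Definition is_levi_civita br S nabla : Prop := forall x y z w,
  3 * S (nabla x y z) w = S (br x y z) w - 2 * S (br x y w) z
                          + S (br y z w) x + S (br z x w) y.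

(* This determines [pre] uniquely, and makes it a 3-pre-Lie multiplication with
   sub-adjacent bracket [br]; see [symplectic_product_exists],
   [symplectic_product_unique], [symplectic_product_prelie3] and
   [symplectic_product_subadjacent]. *)
Definition is_symplectic_product br omega pre : Prop := forall x y z w,
  omega (pre x y z) w = - omega z (br x y w).

Definition subadjacent pre : g -> g -> g -> g :=
  fun x y z => pre x y z + pre y z x + pre z x y.

Definition is_prelie3 pre : Prop :=
  let C := subadjacent pre in
  [/\ trilinear pre,
      forall x y z, pre x y z = - pre y x z,
      forall x1 x2 x3 x4 x5,
        pre x1 x2 (pre x3 x4 x5) = pre (C x1 x2 x3) x4 x5
          + pre x3 (C x1 x2 x4) x5 + pre x3 x4 (pre x1 x2 x5)
    & forall x1 x2 x3 x4 x5,
        pre (C x1 x2 x3) x4 x5 = pre x1 x2 (pre x3 x4 x5)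
          + pre x2 x3 (pre x1 x4 x5) + pre x3 x1 (pre x2 x4 x5)].

Lemma skewE omega u v : omega u v = - omega v u.
Proof. by rewrite hermC /= expr1 mulN1r. Qed.

Lemma formDl omega u v w : omega (u + v) w = omega u w + omega v w.
Proof. exact: linearDl. Qed.

Lemma formDr omega u v w : omega w (u + v) = omega w u + omega w v.
Proof. exact: linearDr. Qed.

Lemma formNl omega u w : omega (- u) w = - omega u w.
Proof. exact: linearNl. Qed.

Lemma formNr omega u w : omega w (- u) = - omega w u.
Proof. exact: linearNr. Qed.

Lemma formZl omega a u w : omega (a *: u) w = a * omega u w.
Proof. exact: linearZl_LR. Qed.

Lemma formZr omega a u w : omega w (a *: u) = a * omega w u.
Proof. by rewrite skewE formZl [omega u w]skewE mulrN opprK. Qed.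

Lemma nondeg_eq0 omega u :
  nondegenerate omega -> (forall w, omega u w = 0) -> u = 0.
Proof.
move=> /eqP nd h; apply/eqP; rewrite -memv0 -nd.
by apply/mem_orthovP => w _; apply: h.
Qed.

Lemma nondeg_inj omega u v :
  nondegenerate omega -> (forall w, omega u w = omega v w) -> u = v.
Proof.
move=> nd h; apply/eqP; rewrite -subr_eq0; apply/eqP/(nondeg_eq0 nd) => w.
by rewrite formDl formNl h subrr.
Qed.

Lemma basis_eq (f f' : g -> K) :
  scalar f -> scalar f' ->
  (forall i : 'I_(\dim {: g}), f (vbasis fullv)`_i = f' (vbasis fullv)`_i) ->
  f =1 f'.
Proof.
move=> lf lf' h u; rewrite (coord_vbasis (memvf u)).
elim/big_rec: _ => [|i v _ IH]; last by rewrite lf lf' h IH.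
have f0 (k : g -> K) : scalar k -> k 0 = 0.
  by move=> lk; have := lk (-1) 0 0; rewrite scaler0 addr0 mulN1r addNr.
by rewrite !f0.
Qed.

Lemma riesz omega (f : g -> K) :
  nondegenerate omega -> scalar f -> exists u, forall w, omega u w = f w.
Proof.
move=> nd lf; set n := \dim {: g}; set e := vbasis (@fullv _ g).
pose F (h : g -> K) : 'rV[K]_n := \row_i h e`_i.
have lP : linear (fun u => F (omega u)).
  by move=> a u v; apply/rowP=> i; rewrite !mxE formDl formZl.
pose P := GRing.isLinear.Build _ _ _ _ _ lP.
pose phi : {linear g -> 'rV[K]_n} := HB.pack (fun u => F (omega u)) P.
have so u : scalar (omega u) by move=> a v w; rewrite formDr formZr.
have inj : lker (linfun phi) == 0%VS.
  apply/lker0P => u v; rewrite !lfunE /= => /rowP huv.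
  apply: (nondeg_inj nd); apply: basis_eq => // i.
  by have := huv i; rewrite !mxE.
have : limg (linfun phi) = fullv.
  apply/eqP; rewrite eqEdim subvf /= limg_dim_eq ?(eqP inj) ?capv0 //.
  rewrite (dimvf (_ : vectType K)) dim_matrix; apply: eq_leq; exact: mul1n.
move=> /vspaceP /(_ (F f)); rewrite memvf => /memv_imgP[u _ hu].
exists u; apply: basis_eq => // i.
by move: hu; rewrite lfunE /= => /rowP /(_ i); rewrite !mxE.
Qed.

Section Products.
Variables (br : g -> g -> g -> g) (omega : {skew_symmetric g}).
Hypotheses (hbr : is_lie3 br) (hom : is_symplectic_on br omega).

Let nd : nondegenerate omega. Proof. by case: hom. Qed.
Let lx y z a u v : br (a *: u + v) y z = a *: br u y z + br v y z.
Proof. by case: hbr => -[h _ _] _ _; apply: h. Qed.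
Let ly x z a u v : br x (a *: u + v) z = a *: br x u z + br x v z.
Proof. by case: hbr => -[_ h _] _ _; apply: h. Qed.
Let lz x y a u v : br x y (a *: u + v) = a *: br x y u + br x y v.
Proof. by case: hbr => -[_ _ h] _ _; apply: h. Qed.
Let s12 x y z : br y x z = - br x y z.
Proof. by case: hbr => _ [h _] _; apply: h. Qed.
Let s23 x y z : br x z y = - br x y z.
Proof. by case: hbr => _ [_ h] _; apply: h. Qed.
Let rot x y z : br y z x = br x y z.
Proof. by rewrite s23 s12 opprK. Qed.
Let FI x y z w v :
  br x y (br z w v) = br (br x y z) w v + br z (br x y w) v + br z w (br x y v).
Proof. by case: hbr. Qed.

Let nl u y z : br (- u) y z = - br u y z.
Proof.
have l0 : br 0 y z = 0.
  by have := lx y z (-1) 0 0; rewrite scaler0 addr0 scaleN1r addNr.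
by have := lx y z (-1) u 0; rewrite l0 !addr0 !scaleN1r.
Qed.

Lemma symplectic_product_exists : exists pre, is_symplectic_product br omega pre.
Proof.
have H (t : g * g * g) :
    exists u, forall w, omega u w = - omega t.2 (br t.1.1 t.1.2 w).
  apply: (riesz nd) => a u v; rewrite lz formDr formZr /=; ring.
have [F hF] := boolp.choice H.
by exists (fun x y z => F (x, y, z)) => x y z w; rewrite hF.
Qed.

Lemma symplectic_product_unique pre pre' :
  is_symplectic_product br omega pre -> is_symplectic_product br omega pre' ->
  forall x y z, pre x y z = pre' x y z.
Proof. by move=> h h' x y z; apply: (nondeg_inj nd) => w; rewrite h h'. Qed.

Lemma symplectic_product_subadjacent pre :
  is_symplectic_product br omega pre ->
  forall x y z, subadjacent pre x y z = br x y z.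
Proof.
move=> h x y z; apply: (nondeg_inj nd) => w; rewrite !formDl !h.
have := hom.2 x y z w; rewrite [br z w x]s23 -(rot w x y).
rewrite !(skewE omega (br _ _ w)) formNl [omega (br z x w) y]skewE => E0.
rewrite -[RHS]subr0 -E0; ring.
Qed.

Lemma symplectic_product_prelie3 pre :
  is_symplectic_product br omega pre -> is_prelie3 pre.
Proof.
move=> h; have hC := symplectic_product_subadjacent h.
split.
- split=> [y z a u v|x z a u v|x y a u v]; apply: (nondeg_inj nd) => w;
    rewrite !(formDl, formZl) !h ?lx ?ly ?(formDr, formZr, formDl, formZl); ring.
- move=> x y z; apply: (nondeg_inj nd) => w.
  by rewrite formNl !h s12 formNr.
- move=> x1 x2 x3 x4 x5; rewrite !hC; apply: (nondeg_inj nd) => w.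
  rewrite !formDl !h !opprK.
  have := congr1 (omega x5) (FI x1 x2 x3 x4 w); rewrite !formDr => ->; ring.
- move=> x1 x2 x3 x4 x5; rewrite !hC; apply: (nondeg_inj nd) => w.
  rewrite !formDl !h !opprK.
  have := congr1 (omega x5) (FI x1 w x2 x3 x4).
  have := congr1 (omega x5) (FI x2 x3 x1 w x4).
  rewrite !formDr (rot x1 x2 x3) (s23 (br x1 x2 x3) x4 w) (s23 x1 x4 (br x2 x3 w)).
  rewrite (rot x2 x1 w) (s12 x1 x2 w) nl (rot x3 x1 w) (s23 x2 x4 (br x3 x1 w)).
  rewrite -(rot (br x1 x2 w) x3 x4) !formNr => -> /eqP.
  rewrite -subr_eq0 => /eqP E0; apply/eqP; rewrite -subr_eq0 -oppr_eq0 -E0.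
  apply/eqP; ring.
Qed.
End Products.
Section Metric.
Variables (br : g -> g -> g -> g) (omega : {skew_symmetric g}) (E : 'End(g)).
Hypotheses (hK : real_or_complex K) (hE : is_para_kahler br omega E).
Let S := para_metric omega E.

Let EE u : E (E u) = u.
Proof.
case: hE => _ _ [[h _ _ _] _] _.
by have := congr1 (fun f : 'End(g) => f u) h; rewrite !lfunE /=.
Qed.
Let nd : nondegenerate omega. Proof. by case: hE => _ []. Qed.

Lemma three_neq0 : (3 : K) != 0.
Proof. by case: hK => R; rewrite pnatr_eq0. Qed.

Lemma para_metric_sym x y : S x y = S y x.
Proof.
case: hE => _ _ _ h; rewrite /S /para_metric.
by rewrite -{1}[x]EE h skewE opprK.
Qed.

Lemma para_metric_nondegenerate x : (forall y, S x y = 0) -> x = 0.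
Proof.
by move=> h; apply: (nondeg_eq0 nd) => y; rewrite -[y]EE; apply: h.
Qed.

Lemma levi_civita_exists : exists nabla, is_levi_civita br S nabla.
Proof.
have [[_ _ lz] _ _] : is_lie3 br by case: hE.
pose f x y z w := S (br x y z) w - 2 * S (br x y w) z
                  + S (br y z w) x + S (br z x w) y.
have fl x y z : scalar (f x y z).
  move=> a u v; rewrite /f /S /para_metric !lz linearP.
  rewrite !(formDl, formZl, formDr, formZr); ring.
have H (t : g * g * g) :
    exists u, forall w, omega u w = f t.1.1 t.1.2 t.2 (E w) / 3.
  apply: (riesz nd) => a u v; rewrite linearP fl; ring.
have [F hF] := boolp.choice H.
exists (fun x y z => F (x, y, z)) => x y z w.
rewrite {1}/S /para_metric hF /= EE mulrC divfK //; exact: three_neq0.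
Qed.

Lemma levi_civita_unique nabla nabla' :
  is_levi_civita br S nabla -> is_levi_civita br S nabla' ->
  forall x y z, nabla x y z = nabla' x y z.
Proof.
move=> h h' x y z; apply: (nondeg_inj nd) => w.
have := h x y z (E w); rewrite -h' /S /para_metric EE.
exact: (mulfI three_neq0).
Qed.
End Metric.
End ThreeLie.

(* Main.v *)
Require Import Defs.
From mathcomp Require Import ring.

Set Implicit Arguments.
Unset Strict Implicit.
Unset Printing Implicit Defensive.

(** Both identities are instances of one statement about the eigenspace [V] of
[E] for a sign [e] with [e * e = 1].  Two facts carry the proof: [V] is
isotropic for [omega], because [E] is an anti-isometry
([eigenspace_isotropic]), and [V] is closed under the bracket, by the
integrability condition of the product structure ([eigenspace_subalgebra]).

For [x], [y], [z] in [V] the symplectic identity collapses the last two terms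
of the Levi-Civita formula, leaving
[3 S(nabla x y z, w) =
  omega([x,y,z], E w) + e omega([x,y,z], w) - 3 e omega([x,y,w], z)],
while [3 S(pre x y z, w) = 3 omega([x,y,E w], z)].  The difference is
[omega([x,y,z], u) - 3 omega([x,y,u], z)] with [u = E w + e w].  This [u] lies
in [V], being [e] times twice the projection of [w] to [V], so all the vectors
paired by [omega] lie in [V] and both terms vanish.  Nondegeneracy of [omega]
then gives the equality of the products, since [2] and [3] are invertible. *)

Local Open Scope ring_scope.

Lemma real_or_complex_natr_neq0 (K : fieldType) (n : nat) :
  real_or_complex K -> (n.+1%:R : K) != 0.
Proof. by case=> R; rewrite Num.Theory.pnatr_eq0. Qed.

Section ParaKahler.
Variables (K : fieldType) (g : vectType K) (br : g -> g -> g -> g).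
Variables (omega : {skew_symmetric g}) (E : 'End(g)).
Hypotheses (hK : real_or_complex K) (hE : is_para_kahler br omega E).

Lemma para_kahler_involutive u : E (E u) = u.
Proof.
have [_ _ [[EE _ _ _] _] _] := hE.
by move/lfunP: EE => /(_ u); rewrite !lfunE.
Qed.

Section Eigenspace.
Variable e : K.
Hypothesis ee : e * e = 1.

Lemma eigenspace_isotropic x y : E x = e *: x -> E y = e *: y -> omega x y = 0.
Proof.
move=> Ex Ey; have [_ _ _ /(_ x y)] := hE.
rewrite Ex Ey formZl formZr mulrA ee mul1r => oxy.
apply: (mulfI (real_or_complex_natr_neq0 1 hK)).
by rewrite mulr0 mulr_natl mulr2n {2}oxy subrr.
Qed.

(** On three eigenvectors the integrability condition reads
[E b = e^3 b + 3 e b - 3 e^2 E b], that is [4 E b = 4 e b]. *)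
Lemma eigenspace_subalgebra x y z :
  E x = e *: x -> E y = e *: y -> E z = e *: z ->
  E (br x y z) = e *: br x y z.
Proof.
move=> Ex Ey Ez.
have [[[lx ly lz] _ _] _ [[_ _ _ /(_ x y z) integrable] _] _] := hE.
have scale_of (f : g -> g) : linear f -> forall a u, f (a *: u) = a *: f u.
  move=> lf a u; have f0 : f 0 = 0.
    by have := lf (-1) 0 0; rewrite scaler0 addr0 scaleN1r addNr.
  by have := lf a u 0; rewrite f0 !addr0.
have Zx a u v w : br (a *: u) v w = a *: br u v w.
  exact: (scale_of (fun t => br t v w)).
have Zy a u v w : br u (a *: v) w = a *: br u v w.
  exact: (scale_of (fun t => br u t w)).
have Zz a u v w : br u v (a *: w) = a *: br u v w.
  exact: (scale_of (fun t => br u v t)).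
rewrite Ex Ey Ez !(Zx, Zy, Zz) !linearZ /= !scalerA ee mul1r !scale1r in integrable.
apply: (scalerI (real_or_complex_natr_neq0 3 hK)).
set b := br x y z in integrable *.
have quadruple (u : g) : 4%:R *: u = u + u + u + u.
  by rewrite scaler_nat !mulrSr mulr0n add0r.
by rewrite !quadruple {1}integrable !subrK.
Qed.

(** The map [E + e] takes values in the eigenspace of [e], because
[E (E + e) = 1 + e E = e (E + e)]. *)
Lemma eigenspace_proj w : E (E w + e *: w) = e *: (E w + e *: w).
Proof.
by rewrite linearD linearZ /= para_kahler_involutive scalerDr scalerA ee
  scale1r addrC.
Qed.

Lemma levi_civita_eigenspace nabla pre x y z :
  is_levi_civita br (para_metric omega E) nabla ->
  is_symplectic_product br omega pre ->
  E x = e *: x -> E y = e *: y -> E z = e *: z ->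
  nabla x y z = pre x y z.
Proof.
move=> hnabla hpre Ex Ey Ez.
have [[[_ _ lz] [s12 s23] _] [nd sympl] _ _] := hE.
(* As [E] is onto, pairing with all [E w] suffices; it turns [omega] into the
metric of the Levi-Civita formula. *)
apply: (nondeg_inj nd) => w'; rewrite -[w']para_kahler_involutive.
move: (E w') => w.
apply: (mulfI (real_or_complex_natr_neq0 2 hK)).
have := hnabla x y z w; rewrite /para_metric => ->.
rewrite hpre -skewE Ex Ey Ez !formZr.
(* The vector [u = E w + e w] and the two vanishing pairings it enters. *)
have Eu := eigenspace_proj w.
have := eigenspace_isotropic (eigenspace_subalgebra Ex Ey Ez) Eu.
have := eigenspace_isotropic (eigenspace_subalgebra Ex Ey Eu) Ez.
rewrite [E w + _]addrC lz formDl formDr formZl formZr => oxyu oxyz.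
have := sympl x y z w.
rewrite [br z w x]s23 [br w x y]s12 [br x w y]s23 opprK formNl => closed.
have -> : omega (br x y (E w)) z = - (e * omega (br x y w) z).
  by apply/eqP; rewrite -addr_eq0 addrC oxyu.
have -> : omega (br x y z) (E w) = - (e * omega (br x y z) w).
  by apply/eqP; rewrite -addr_eq0 addrC oxyz.
have -> : omega (br x y z) w = omega (br y z w) x + omega (br z x w) y
                               + omega (br x y w) z.
  by apply/eqP; rewrite -subr_eq0 -closed; apply/eqP; ring.
ring.
Qed.

End Eigenspace.
End ParaKahler.

Theorem proposition8p10 (K : fieldType) (hK : real_or_complex K)
    (g : vectType K) (br : g -> g -> g -> g) (omega : {skew_symmetric g})
    (E : 'End(g)) (hE : is_para_kahler br omega E)
    (nabla : g -> g -> g -> g)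
    (hnabla : is_levi_civita br (para_metric omega E) nabla)
    (pre : g -> g -> g -> g) (hpre : is_symplectic_product br omega pre) :
  (forall x1 x2 x3 : g,
     x1 \in leigenspace E 1 -> x2 \in leigenspace E 1 ->
     x3 \in leigenspace E 1 ->
     nabla x1 x2 x3 = pre x1 x2 x3) /\
  (forall a1 a2 a3 : g,
     a1 \in leigenspace E (-1) -> a2 \in leigenspace E (-1) ->
     a3 \in leigenspace E (-1) ->
     nabla a1 a2 a3 = pre a1 a2 a3).
Proof.
have eigenvectorP (a : K) u : u \in leigenspace E a -> E u = a *: u.
  rewrite memv_ker add_lfunE opp_lfunE scale_lfunE id_lfunE subr_eq0.
  by move/eqP.
split=> x y z /eigenvectorP Ex /eigenvectorP Ey /eigenvectorP Ez.
  by apply: (levi_civita_eigenspace hK hE (mulr1 1) hnabla hpre).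
have signN : (-1) * (-1) = 1 :> K by rewrite mulrNN mulr1.
by apply: (levi_civita_eigenspace hK hE signN hnabla hpre).
Qed.
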